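(* Let $G$ be a countable group acting extremely transitively on a Cantor set $X$, and let $m\ge1$. If $\mathcal{M}_G(X)\neq\emptyset$ and $\nu$ is an ergodic $G$-invariant Borel probability measure on $X^m$ (for the diagonal action), then $\nu=(\mu^{\otimes r})^{\mathcal{I}}$ for some partition $\mathcal{I}$ of $\{1,\dots,m\}$ into $r$ blocks, where $\mu$ is the unique $G$-invariant Borel probability measure on $X$. Hence if $\mathcal{M}_G(X)\ne\emptyset$, then $|\mathcal{M}^e_G(X^m)|=B_m$ for every $m\ge1$, where $B_m$ denotes the $m$-th Bell number.
   Context: Let $X$ be a Cantor set with a compatible metric. $\mathcal{M}_G(Z)$ (resp. $\mathcal{M}_G^e(Z)$) is the set of $G$-invariant (resp. ergodic $G$-invariant) Borel probability measures on $Z$; $G$ acts on $X^m$ diagonally. For a partition $\mathcal{I}=\{I_1,\dots,I_r\}$ of $\{1,\dots,m\}$ into nonempty blocks, $\theta_{\mathcal{I}}\colon X^r\to X^m$ is the embedding for which $\theta_{\mathcal{I}}(x_1,\dots,x_r)$ has $x_k$ in every coordinate whose index lies in $I_k$. For a measure $\lambda$ on $X^r$, $\lambda^{\mathcal{I}}=(\theta_{\mathcal{I}})_*\lambda$. $\mu^{\otimes r}$ is the $r$-fold product measure. An extremely transitive action admits at most one invariant Borel probability measure. A tree structure for $X$ is a sequence of finite clopen partitions $\mathcal{C}_i=\{C^i_1,\dots,C^i_{\kappa(i)}\}$, $i\ge 1$, of $X$ (into nonempty sets) such that: (a) $\mathcal{C}_{i+1}$ refines $\mathcal{C}_i$ for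 every $i$; (b) $\max\{\operatorname{diam}(C): C\in\mathcal{C}_i\}\to 0$ as $i\to\infty$; (c) for all $k\ge1$ and $C\in\mathcal{C}_k$, $\inf_{n\ge k}\frac{|\{D\in\mathcal{C}_n: D\subset C\}|}{\kappa(n)}>0$. The action of $G$ (by homeomorphisms) is extremely transitive with respect to $(\mathcal{C}_i)$ if for each $i\ge1$, each $1\le r\le\kappa(i)$, and all pairs of tuples $(A_1,\dots,A_r)$, $(B_1,\dots,B_r)$, each consisting of pairwise distinct elements of $\mathcal{C}_i$, there is $g\in G$ with $(g(A_1),\dots,g(A_r))=(B_1,\dots,B_r)$. $G$ acts extremely transitively on $X$ if there is a tree structure with respect to which the action is extremely transitive. *)

(* Defs.v *)
From HB Require Import structures.
From mathcomp Require Import all_boot all_order all_algebra finmap.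
From mathcomp Require Import all_classical all_reals all_analysis.
From mathcomp Require Import giry.

Set Implicit Arguments.
Unset Strict Implicit.
Unset Printing Implicit Defensive.
Import Order.TTheory GRing.Theory Num.Theory.
Import numFieldNormedType.Exports.

Local Open Scope classical_set_scope.
Local Open Scope ring_scope.

(* The library's measurable types are pointed, so the metric space carrying
   the Borel sets is pointed too (in particular it is not empty). *)
#[short(type="pmetricType")]
HB.structure Definition PMetric (K : numDomainType) :=
  {M of Metric K M & Pointed M}.

Definition borel (X : ptopologicalType) := g_sigma_algebraType (@open X).

Section tree_structure.
Context {R : realType} {X : metricType R}.

Definition diam (A : set X) : R := sup [set mdist x y | x in A & y in A].

Definition mesh (P : {fset set X}) : R :=
  \big[Order.max/0]_(A <- P) diam A.

Definition clopen_partition (P : {fset set X}) : Prop :=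
  [/\ forall A, A \in P -> clopen A /\ A !=set0,
      trivIset [set` P] id
    & \bigcup_(A in [set` P]) A = [set: X] ].

Definition density (P : {fset set X}) (A : set X) : R :=
  #|` [fset D in P | `[< (D `<=` A)%classic >]]%fset |%:R / #|` P |%:R.

(* Levels are indexed from 0 instead of 1. *)
Definition tree_structure (C : nat -> {fset set X}) : Prop :=
  [/\ forall i, clopen_partition (C i),
      forall i D, D \in C i.+1 -> exists2 A, A \in C i & D `<=` A,
      mesh (C i) @[i --> \oo] --> (0 : R)
    & forall k A, A \in C k ->
        0 < inf [set density (C n) A | n in [set n | (k <= n)%N]] ].

End tree_structure.

Section actions.
Context {G : groupType}.

Definition homeo_action {X : topologicalType} (act : G -> X -> X) : Prop :=
  [/\ forall x, act 1%g x = x,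
      forall g h x, act (g * h)%g x = act g (act h x)
    & forall g, continuous (act g)].

Definition extremely_transitive_wrt {R : realType} {X : metricType R}
    (act : G -> X -> X) (C : nat -> {fset set X}) : Prop :=
  forall (i r : nat) (A B : r.-tuple (set X)),
    (1 <= r <= #|` C i |)%N ->
    uniq A -> {subset A <= C i} -> uniq B -> {subset B <= C i} ->
    exists g, forall k : 'I_r, act g @` tnth A k = tnth B k.

Definition extremely_transitive {R : realType} {X : metricType R}
    (act : G -> X -> X) : Prop :=
  exists2 C, tree_structure C & extremely_transitive_wrt act C.

Definition diag_act {X : Type} (act : G -> X -> X) (m : nat)
    (g : G) (x : m.-tuple X) : m.-tuple X := [tuple of map (act g) x].

Section invariant_measures.
Context {d : measure_display} {Z : measurableType d} (R : realType).
Variable act : G -> Z -> Z.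

Definition invariant_measures : set (probability Z R) :=
  [set nu : probability Z R | forall g (A : set Z), measurable A -> nu (act g @^-1` A) = nu A].

Definition ergodic_measures : set (probability Z R) :=
  [set nu | invariant_measures nu /\
    forall A, measurable A -> (forall g, act g @^-1` A = A) ->
      nu A = 0%E \/ nu A = 1%E].

End invariant_measures.
End actions.

(* Terms of type [probability Z R] are set functions on all subsets of Z, and
   may differ outside the sigma-algebra.  The mathematical measure is the
   restriction to measurable sets, so measures are compared by [measure_eq] and
   counted through [on_measurable]. *)
Definition on_measurable {d : measure_display} {Z : measurableType d}
    {R : realType} (nu : probability Z R) : {A : set Z | measurable A} -> \bar R :=
  fun A => nu (sval A).

Section product.
Context {d : measure_display} {T : measurableType d} {R : realType}.

Definition cons_pair (n : nat) (x : T * n.-tuple T) : n.+1.-tuple T :=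
  [tuple of x.1 :: x.2].

Let measurable_cons_pair n : measurable_fun [set: T * n.-tuple T] (@cons_pair n).
Proof. exact: measurable_cons. Qed.

HB.instance Definition _ n :=
  @isMeasurableFun.Build _ _ _ _ (@cons_pair n) (@measurable_cons_pair n).

Fixpoint tuple_power (mu : probability T R) (n : nat) :
    probability (n.-tuple T) R :=
  if n is n'.+1 then distribution (mu \x tuple_power mu n')%E (@cons_pair n')
  else dirac [tuple].


Lemma tuple_power_box (mu : probability T R) (n : nat) (A : 'I_n -> set T) :
  (forall i, measurable (A i)) ->
  tuple_power mu n [set x | forall i, A i (tnth x i)] = (\prod_i mu (A i))%E.
Proof.
elim: n A => [|n IHn] A mA.
  rewrite big_ord0 /= diracE mem_set//=.
  by case.
rewrite big_ord_recl -IHn; last by move=> i; exact: mA.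
rewrite /= /distribution /pushforward -product_measure1E//.
- congr (product_measure1 _ _ _); apply/seteqP; split=> -[x t] /=.
    move=> Axt; split; first exact: (Axt ord0).
    by move=> i; have := Axt (lift ord0 i); rewrite tnthS.
  move=> [Ax At] i; case: (unliftP ord0 i) => [j|] ->; last exact: Ax.
  by rewrite tnthS; exact: At.
- rewrite (_ : [set _ | _] =
    \big[setI/setT]_(i < n) ((fun x : n.-tuple T => tnth x i) @^-1` A (lift ord0 i))).
    apply: bigsetI_measurable => i _; rewrite -[X in measurable X]setTI.
    exact: measurable_tnth.
  rewrite -bigcap_seq; apply/seteqP; split=> x /=.
    by move=> Ax i _; exact: Ax.
  by move=> Ax i; apply: Ax; rewrite /= mem_index_enum.
Qed.

End product.

Lemma nbhs_box (X : uniformType) (n : nat) (f : {ptws 'I_n -> X})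
    (U : set {ptws 'I_n -> X}) : nbhs f U ->
  exists2 c : 'I_n -> set X, (forall i, nbhs (f i) (c i)) &
    [set g | forall i, c i (g i)] `<=` U.
Proof.
pose F : set_system {ptws 'I_n -> X} :=
  [set W | exists2 c : 'I_n -> set X, (forall i, nbhs (f i) (c i)) &
    [set g | forall i, c i (g i)] `<=` W].
have FF : Filter F.
  split.
  - by exists (fun=> setT) => // i; exact: filterT.
  - move=> P Q [c cf cP] [e ef eQ]; exists (fun i => c i `&` e i).
      by move=> i; exact: filterI.
    by move=> g gce; split; [apply: cP|apply: eQ] => i; have [] := gce i.
  - by move=> P Q PQ [c cf cP]; exists c => //; exact: subset_trans PQ.
suff Ff : {ptws, F --> (f : 'I_n -> X)} by exact: Ff.
apply/cvg_sup => i; apply/cvg_image.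
  by apply/seteqP; split=> // x _; exists (fun=> x).
move=> A fA; exists [set g : {ptws 'I_n -> X} | A (g i)]; last first.
  apply/seteqP; split=> [x [g Ag <-]//|x Ax].
  by exists (fun=> x).
exists (fun j => if j == i then A else setT).
  by move=> j; case: eqP => [->//|_]; exact: filterT.
by move=> g /(_ i); rewrite eqxx.
Qed.

(* The library's sigma-algebra on tuples over [borel X] is the Borel
   sigma-algebra of the product topology. *)
Lemma measurable_tuple_borel (R : realType) (X : pmetricType R) (n : nat) :
  compact [set: X] ->
  @measurable _ (n.-tuple (borel X)) =
  [set A | <<s @open {ptws 'I_n -> X} >> [set f : 'I_n -> X | A [tuple f i | i < n]]].
Proof.
move=> cX; apply/seteqP; split.
- apply: smallest_sub.
    have := @sigma_algebra_image _ _ setT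
      (fun f : 'I_n -> X => [tuple f i | i < n]) _
      (@smallest_sigma_algebra _ setT (@open {ptws 'I_n -> X})).
    rewrite /image_set_system/=; congr (sigma_algebra _ _).
    by apply/seteqP; split=> A /=; rewrite setTI.
  move=> A; rewrite -bigcup_seq => -[i _] [B mB <-] /=.
  rewrite (_ : [set _ | _] = (fun f : 'I_n -> X => f i) @^-1` B); last first.
    by apply/seteqP; split=> f /=; rewrite tnth_mktuple; [case|split].
  suff: @open X `<=` [set B | <<s @open {ptws 'I_n -> X} >>
                                ((fun f : 'I_n -> X => f i) @^-1` B)].
    move=> oX; move: B mB; apply: smallest_sub => //.
    have := @sigma_algebra_image _ _ setT (fun f : 'I_n -> X => f i) _
      (@smallest_sigma_algebra _ setT (@open {ptws 'I_n -> X})).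
    rewrite /image_set_system/=; congr (sigma_algebra _ _).
    by apply/seteqP; split=> C /=; rewrite setTI.
  move=> U oU; apply: sub_sigma_algebra.
  by apply: open_comp oU => f _; exact: (@proj_continuous 'I_n (fun=> X) i).
- have [B cB [oB Bbase]] := compact_second_countable cX.
  have [e eB] : exists e : nat -> set X, B `<=` range e.
    by have /pcard_surjP[e eB] := cB; exists e => V /eB[k _ <-]; exists k.
  suff oM : @open {ptws 'I_n -> X} `<=`
      [set U | measurable ((fun t : n.-tuple (borel X) => tnth t : 'I_n -> X) @^-1` U)].
    move=> A /= mA.
    have -> : A = (fun t : n.-tuple (borel X) => tnth t : 'I_n -> X) @^-1`
        [set f : 'I_n -> X | A [tuple f i | i < n]].
      apply/funext => t /=; congr (A _).
      by apply/eq_from_tnth => i; rewrite tnth_mktuple.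
    have sM : <<s @open {ptws 'I_n -> X} >> `<=` [set U |
        measurable ((fun t : n.-tuple (borel X) => tnth t : 'I_n -> X) @^-1` U)].
      apply: smallest_sub; last exact: oM.
      have := @sigma_algebra_image _ _ setT
        (fun t : n.-tuple (borel X) => tnth t : 'I_n -> X) _
        (@sigma_algebra_measurable _ (n.-tuple (borel X))).
      rewrite /image_set_system/=; congr (sigma_algebra _ _).
      by apply/seteqP; split=> C /=; rewrite setTI.
    exact: sM.
  move=> U oU /=.
  pose box (c : {ffun 'I_n -> nat}) : set ('I_n -> X) :=
    [set g | forall i, (e (c i))° (g i)].
  pose V (k : nat) : set ('I_n -> X) :=
    if @choice.unpickle {ffun 'I_n -> nat} k is Some c then
      if `[< box c `<=` U >] then box c else set0 else set0.
  have -> : U = \bigcup_k V k.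
    apply/seteqP; split=> [f Uf|f [k _]]; last first.
      rewrite /V; case: choice.unpickle => // c; case: asboolP => // cU.
      exact: cU.
    have [c cf cU] := nbhs_box (open_nbhs_nbhs (conj oU Uf)).
    have h i : exists k, (e k)° (f i) /\ e k `<=` c i.
      have [W [BW Wf] Wc] := Bbase (f i) (c i) (cf i).
      have [k _ ek] := eB _ BW; exists k; rewrite ek; split => //.
      by apply: open_nbhs_nbhs; split => //; exact: oB.
    have [k kP] := choice h.
    exists (@choice.pickle {ffun 'I_n -> nat} [ffun i => k i]) => //; rewrite /V choice.pickleK.
    case: asboolP => [_ i|].
      by rewrite ffunE; exact: (kP i).1.
    case; move=> g /= gk; apply: cU => i.
    by apply: (kP i).2; apply: interior_subset; have := gk i; rewrite ffunE.
  rewrite preimage_bigcup; apply: bigcupT_measurable => k.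
  rewrite /V; case: choice.unpickle => [c|]; last by rewrite preimage_set0.
  case: asboolP => _; last by rewrite preimage_set0.
  rewrite (_ : _ @^-1` _ = \big[setI/setT]_(i < n)
    ((fun x : n.-tuple (borel X) => tnth x i) @^-1` (e (c i))°)).
    apply: bigsetI_measurable => i _; rewrite -[X in measurable X]setTI.
    apply: measurable_tnth => //; apply: sub_sigma_algebra.
    exact: open_interior.
  rewrite -bigcap_seq; apply/seteqP; split=> x /=.
    by move=> Ax i _; exact: Ax.
  by move=> Ax i; apply: Ax; rewrite /= mem_index_enum.
Qed.

Section partitions.
Context {d : measure_display} {T : measurableType d} {m r : nat}.

Definition ordered_partition (I : r.-tuple {set 'I_m}) : bool :=
  uniq I && finset.partition [set:: I] [set: 'I_m].

(* The i-th coordinate is x_k for the first k such that i \in I_k. *)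
Definition block_embed (I : r.-tuple {set 'I_m}) (x : r.-tuple T) : m.-tuple T :=
  [tuple nth point x (find (fun B : {set 'I_m} => i \in B) I) | i < m].

Let measurable_block_embed I : measurable_fun [set: r.-tuple T] (block_embed I).
Proof.
apply/measurable_fun_tnthP => i.
set k := find (fun B : {set 'I_m} => i \in B) I.
rewrite (_ : _ \o _ = fun x : r.-tuple T => nth point x k); last first.
  by apply/funext => x /=; rewrite tnth_mktuple.
have [kr|rk] := ltnP k r.
  rewrite (_ : (fun x => _) = fun x : r.-tuple T => tnth x (Ordinal kr)).
    exact: measurable_tnth.
  by apply/funext => x; rewrite (tnth_nth point).
rewrite (_ : (fun x => _) = cst point); first exact: measurable_cst.
by apply/funext => x; rewrite nth_default// size_tuple.
Qed.

HB.instance Definition _ I :=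
  @isMeasurableFun.Build _ _ _ _ (block_embed I) (measurable_block_embed I).

End partitions.

Definition bell_number (m : nat) : nat :=
  #|[pred P : {set {set 'I_m}} | finset.partition P [set: 'I_m]]|.

(* Main.v *)
Require Import Defs.
From HB Require Import structures.
From mathcomp Require Import all_boot all_order all_algebra finmap.
From mathcomp Require Import all_classical all_reals all_analysis.
From mathcomp Require Import giry.

Set Implicit Arguments.
Unset Strict Implicit.
Unset Printing Implicit Defensive.
Import Order.TTheory GRing.Theory Num.Theory.
Import numFieldNormedType.Exports.

Local Open Scope classical_set_scope.

(** The diagonal action preserves the equality pattern of a tuple, that is, the
    relation saying which of its coordinates coincide.  There are finitely many
    patterns, so an ergodic measure on [X^m] is carried by the tuples of a single
    pattern [e] ([ergodic_with_pattern]).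

    The heart of the proof is that an invariant probability carried by the
    tuples of pattern [e] is unique ([invariant_with_pattern_unique]).  Replace
    each coordinate by the piece of [C n] that contains it; the resulting code
    has pattern [e] for all large [n], so the tuples whose level-[n] code has
    pattern [e] have mass tending to 1.  Extreme transitivity says that [G] is
    transitive on the codes of pattern [e], so that an invariant measure gives
    the same mass to each of the corresponding boxes.  Hence on a union [S] of
    level-[k] boxes, the mass of the part of [S] with level-[n] code of pattern
    [e] is proportional to a number of codes, with a factor independent of [S],
    and two invariant measures carried by the pattern [e] agree on [S] in the
    limit.  Such sets [S] form a pi-system generating the sigma-algebra.

    Everything else follows from this uniqueness.  For [m = 1] there is only one
    pattern, so the invariant measure [mu] on [X] is unique.  The image of
    [mu^r] under a block embedding is invariant, and it is carried by the pattern
    of the partition: [X] has no isolated point, so the number of pieces of [C n]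
    is unbounded, and since they all have the same mass, independent points drawn
    from [mu] are almost surely distinct ([tuple_power_distinct]).  It is
    therefore the unique invariant measure of that pattern.  It is also ergodic,
    because conditioning it on an invariant set of positive mass would produce
    another invariant measure of the same pattern ([with_pattern_ergodic]).
    Patterns of tuples correspond bijectively to set partitions of the index
    set, whence the Bell number. *)

(** * Sets of full mass and maps to finite types *)

Lemma probability_setI_full {d} {T : measurableType d} {R : realType}
    (nu : probability T R) (A E : set T) :
  measurable A -> measurable E -> nu E = 1%E -> nu (A `&` E) = nu A.
Proof.
move=> mA mE nuE; rewrite [RHS](measureDI nu mA mE) [X in (X + _)%E](_ : _ = 0%E).
  by rewrite add0e.
apply/eqP; rewrite eq_le measure_ge0 andbT.
have <- : nu (~` E) = 0%E by rewrite probability_setC// nuE subee.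
apply: le_measure; rewrite ?inE; [exact: measurableD|exact: measurableC|].
by rewrite setDE; exact: subIsetr.
Qed.

Section finite_valued.
Context {d : measure_display} {T : measurableType d} {F : finType} (f : T -> F).
Hypothesis mf : forall c, measurable [set x | f x = c].

Lemma measurable_finite_valued (P : set F) : measurable [set x | P (f x)].
Proof.
rewrite (_ : [set x | _] = \bigcup_(c in P) [set x | f x = c]).
  exact: fin_bigcup_measurable.
by apply/seteqP; split=> [x Px|x [c Pc /= ->]//]; exists (f x).
Qed.

Lemma measure_finite_valued (R : realType) (nu : measure T R)
    (S : set T) : measurable S ->
  nu S = (\sum_(c : F) nu (S `&` [set x | f x = c]))%E.
Proof.
move=> mS.
have SE : S = \bigcup_(c in [set: F]) (S `&` [set x | f x = c]).
  by apply/seteqP; split=> [x Sx|x [c _ []]//]; exists (f x).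
rewrite [in LHS]SE measure_fin_bigcup//.
- rewrite (fsbigTE (seq_fset tt (index_enum F))); last first.
    by move=> c; rewrite seq_fsetE mem_index_enum.
  apply: perm_big; apply: uniq_perm; rewrite ?fset_uniq ?index_enum_uniq// => c.
  by rewrite seq_fsetE.
- exact: finite_finset.
- by move=> c c' _ _ [x [[_ <-] [_ <-]]].
- by move=> c _; exact: measurableI.
Qed.

End finite_valued.

(** * Equality patterns *)

Section pattern.
Context {I : finType}.

Definition pattern {T : eqType} (u : I -> T) : {ffun I * I -> bool} :=
  [ffun p => u p.1 == u p.2].

Lemma patternP {T T' : eqType} (u : I -> T) (v : I -> T') :
  pattern u = pattern v <-> forall i j, (u i == u j) = (v i == v j).
Proof.
split=> [/ffunP uv i j|uv]; first by have := uv (i, j); rewrite !ffunE.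
by apply/ffunP => -[i j]; rewrite !ffunE.
Qed.

Lemma pattern_inj {T T' : eqType} (f : T -> T') (u : I -> T) :
  injective f -> pattern (f \o u) = pattern u.
Proof. by move=> finj; apply/patternP => i j; rewrite /= (inj_eq finj). Qed.

End pattern.

(** * Pieces of a tree structure *)

Section tree.
Context {R : realType} {X : pmetricType R} (C : nat -> {fset set X}).
Hypotheses (cX : compact [set: X]) (treeC : tree_structure C).

(** The diameter is a supremum of reals, which is meaningful only for bounded
    sets; compactness of [X] provides the bound. *)
Lemma diam_ub (A : set X) (x y : X) : A x -> A y -> (mdist x y <= diam A)%R.
Proof.
move=> Ax Ay.
suff /ub_le_sup : has_ubound [set mdist a b | a in A & b in A].
  by apply; exists x => //; exists y.
have [M XM] : exists M : R, forall z : X, (mdist (point : X) z < M)%R.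
  have /compact_near_coveringP/(_ _ (+oo%R : set_system R)
    (fun M (z : X) => mdist (point : X) z < M)%R _) := cX.
  case=> [z _|M [_ XM]].
    near=> z' M => /=.
    apply: (le_lt_trans (metric_triangle (point : X) z z')).
    apply: (@lt_trans _ _ (mdist (point : X) z + 1)%R).
      rewrite ltrD2l; near: z'.
      by have := nbhsx_ballx z 1%R ltr01; rewrite ballEmdist.
    by near: M; apply: nbhs_pinfty_gt; rewrite num_real.
  exists (M + 1)%R => z; apply: XM => //.
  by rewrite ltrDl.
exists (M + M)%R => _ [a _ [b _ <-]].
apply: (le_trans (metric_triangle a (point : X) b)).
by rewrite metric_sym lerD// ltW.
Unshelve. all: by end_near. Qed.

Lemma exists_piece n x : exists A : C n, (val A) x.
Proof.
have [/(_ n)[_ _ cov] _ _ _] := treeC.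
have : [set: X] x by [].
by rewrite -cov => -[A /= CA Ax]; exists [` CA]%fset.
Qed.

Definition piece n x : C n := sval (cid (exists_piece n x)).

Lemma pieceP n x : (val (piece n x)) x.
Proof. exact: (svalP (cid (exists_piece n x))). Qed.

Lemma pieceE n (A : C n) : val A = [set x | piece n x = A].
Proof.
apply/seteqP; split=> [x Ax|x <-]; last exact: pieceP.
have [/(_ n)[_ tC _] _ _ _] := treeC.
apply: val_inj; apply: tC => /=; rewrite ?fsvalP//.
by exists x; split=> //; exact: pieceP.
Qed.

Lemma open_piece n (A : C n) : open (val A).
Proof. by have [/(_ n)[/(_ _ (fsvalP A))[[]]]] := treeC. Qed.

Lemma measurable_piece n (A : C n) :
  measurable ([set x | piece n x = A] : set (borel X)).
Proof. by rewrite -pieceE; apply: sub_sigma_algebra; exact: open_piece. Qed.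

Lemma piece_coarsen k n x y : (k <= n)%N ->
  piece n x = piece n y -> piece k x = piece k y.
Proof.
elim: n => [|n IHn]; first by rewrite leqn0 => /eqP ->.
rewrite leq_eqVlt => /predU1P[->//|]; rewrite ltnS => kn xy; apply: IHn => //.
have [_ /(_ n _ (fsvalP (piece n.+1 y)))[A CA yA] _ _] := treeC.
have /= := pieceE [` CA]%fset => EA.
have Ay : A y by apply: yA; exact: pieceP.
have Ax : A x by apply: yA; rewrite -xy; exact: pieceP.
by move: Ax Ay; rewrite EA /= => -> ->.
Qed.

Lemma piece_small (e : R) : (0 < e)%R ->
  exists N, forall n x y, (N <= n)%N -> piece n x = piece n y -> (mdist x y < e)%R.
Proof.
move=> e0; have [_ _ /cvgr_lt/(_ _ e0) [N _ NC] _] := treeC.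
exists N => n x y Nn xy; apply: le_lt_trans (NC n Nn).
apply: (@le_trans _ _ (diam (val (piece n x)))).
  by apply: diam_ub; [|rewrite xy]; exact: pieceP.
by rewrite /mesh; apply: le_bigmax_seq => //; exact: fsvalP.
Qed.

Lemma piece_separates x y : x <> y ->
  exists N, forall n, (N <= n)%N -> piece n x <> piece n y.
Proof.
move=> /eqP; rewrite -mdist_gt0 => /piece_small[N NC].
by exists N => n Nn /NC; rewrite ltxx => /(_ Nn).
Qed.

Lemma piece_sub_open (U : set X) x : open U -> U x ->
  exists n, val (piece n x) `<=` U.
Proof.
move=> oU Ux; have [e /= e0 eU] : exists2 e : R, (0 < e)%R & ball x e `<=` U.
  by have [e /= e0 ?] := (nbhs_ballP _ _).1 (open_nbhs_nbhs (conj oU Ux)); exists e.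
have [n nC] := piece_small e0; exists n => y; rewrite pieceE /= => yx.
by apply: eU; rewrite ballEmdist /=; exact: (nC n).
Qed.

End tree.

(** * Codes of tuples *)

Section code.
Context {R : realType} {X : pmetricType R} {C : nat -> {fset set X}}.
Hypotheses (cX : compact [set: X]) (treeC : tree_structure C).
Context {m : nat}.

Definition code n (x : m.-tuple X) : {ffun 'I_m -> C n} :=
  [ffun i => piece treeC n (tnth x i)].

Lemma codeP n x (D : {ffun 'I_m -> C n}) :
  code n x = D <-> forall i, piece treeC n (tnth x i) = D i.
Proof.
by split=> [<- i|xD]; [rewrite ffunE|apply/ffunP => i; rewrite ffunE].
Qed.

Lemma code_box n (D : {ffun 'I_m -> C n}) :
  [set x | code n x = D] = [set x | forall i, val (D i) (tnth x i)].
Proof.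
apply/seteqP; split=> x /=; rewrite codeP => xD i; have := xD i;
  by rewrite (pieceE treeC).
Qed.

Lemma measurable_code n (D : {ffun 'I_m -> C n}) :
  measurable ([set x | code n x = D] : set (m.-tuple (borel X))).
Proof.
rewrite (_ : [set x | _] = \bigcap_(i in [set: 'I_m])
    ((fun x : m.-tuple (borel X) => tnth x i) @^-1`
      [set y | piece treeC n y = D i])).
  apply: fin_bigcap_measurable => [|i _]; first exact: finite_finset.
  rewrite -[X in measurable X]setTI.
  by apply: measurable_tnth => //; exact: measurable_piece.
by apply/seteqP; split=> x /= => [/codeP xD i _|xD]; [exact: xD|apply/codeP => i; exact: xD].
Qed.

Lemma code_coarsen k n x y : (k <= n)%N -> code n x = code n y ->
  code k x = code k y.
Proof.
move=> kn /ffunP xy; apply/ffunP => i; rewrite !ffunE.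
by apply: (piece_coarsen kn); have := xy i; rewrite !ffunE.
Qed.

(** Distinct coordinates are eventually separated by the partitions, and equal
    ones never are. *)
Lemma code_pattern_stable x : exists N, forall n, (N <= n)%N ->
  pattern (code n x) = pattern (tnth x).
Proof.
have /choice[N NP] : forall p : 'I_m * 'I_m, exists N, forall n, (N <= n)%N ->
    (code n x p.1 == code n x p.2) = (tnth x p.1 == tnth x p.2).
  move=> p; have [xp|/eqP xp] := eqVneq (tnth x p.1) (tnth x p.2).
    by exists 0%N => n _; rewrite !ffunE xp !eqxx.
  have [N NP] := piece_separates cX treeC xp; exists N => n /NP/eqP.
  by rewrite !ffunE => /negbTE.
exists (\max_p N p) => n Nn; apply/ffunP => p; rewrite [LHS]ffunE [RHS]ffunE.
by apply: NP; exact: leq_trans (leq_bigmax p) Nn.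
Qed.

(** Unions of level-[n] boxes, described by saturation so that stability under
    intersection and refinement is immediate. *)
Definition code_determined n (S : set (m.-tuple X)) : Prop :=
  forall x y, code n x = code n y -> S x -> S y.

Lemma code_determinedW k n S : (k <= n)%N ->
  code_determined k S -> code_determined n S.
Proof. by move=> kn kS x y /(code_coarsen kn); exact: kS. Qed.

Lemma code_determinedE n S : code_determined n S ->
  S = [set x | [set code n y | y in S] (code n x)].
Proof.
move=> nS; apply/seteqP; split=> [x Sx|x [y Sy yx]]; first by exists x.
exact: nS yx Sy.
Qed.

Lemma measurable_code_determined n (S : set (m.-tuple (borel X))) :
  code_determined n S -> measurable S.
Proof.
move=> /code_determinedE ->.
by apply: measurable_finite_valued => D; exact: measurable_code.
Qed.

Let generator : set (set (m.-tuple (borel X))) :=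
  [set S | exists n, code_determined n S].

(** An open set of [X] is the countable union, over the levels, of the pieces
    that it contains, so a condition that one coordinate be in an open set is a
    countable union of sets determined by codes. *)
Lemma measurable_tuple_code :
  (measurable : set (set (m.-tuple (borel X)))) = <<s generator >>.
Proof.
apply/seteqP; split; last first.
  apply: smallest_sub; first exact: sigma_algebra_measurable.
  by move=> S [n]; exact: measurable_code_determined.
apply: smallest_sub; first exact: smallest_sigma_algebra.
move=> S; rewrite -bigcup_seq => -[i _] [B mB <-] /=; rewrite setTI.
suff : @open X `<=` [set B | <<s generator >>
         ((fun x : m.-tuple (borel X) => tnth x i) @^-1` B)].
  move=> oX; move: B mB; apply: smallest_sub => //.
  have := @sigma_algebra_image _ _ setT (fun x : m.-tuple (borel X) => tnth x i) _
    (@smallest_sigma_algebra _ setT generator).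
  rewrite /image_set_system/=; congr (sigma_algebra _ _).
  by apply/seteqP; split=> A /=; rewrite setTI.
move=> U oU /=.
rewrite (_ : _ @^-1` _ = \bigcup_n [set x : m.-tuple (borel X) |
    val (piece treeC n (tnth x i)) `<=` U]); last first.
  apply/seteqP; split=> x /=; first by move=> /(piece_sub_open cX treeC oU)[n]; exists n.
  by move=> [n _]; apply; exact: pieceP.
apply: sigma_algebra_bigcup => n; apply: sub_sigma_algebra; exists n.
move=> x y /ffunP/(_ i); rewrite !ffunE => xy /=.
by rewrite xy.
Qed.

(** Sets determined by codes form a pi-system, as a common refinement
    determines both sets of a pair. *)
Lemma measure_eq_code (mu nu : probability (m.-tuple (borel X)) R) :
  (forall n S, code_determined n S -> mu S = nu S) -> measure_eq mu nu.
Proof.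
move=> munu S; apply: (measure_unique generator (fun=> setT)).
- exact: measurable_tuple_code.
- move=> A B [k kA] [n nB]; exists (maxn k n) => x y xy [Ax Bx]; split.
    by apply: (code_determinedW (leq_maxl k n) kA) Ax.
  by apply: (code_determinedW (leq_maxr k n) nB) Bx.
- by move=> _; exists 0%N.
- by rewrite bigcup_const//; exists 0%N.
- by move=> A [n]; exact: munu.
- by move=> _; rewrite [ltLHS]probability_setT ltry.
Qed.

Lemma measure_code_sum (nu : probability (m.-tuple (borel X)) R) n
    (P : set {ffun 'I_m -> C n}) :
  nu [set x | P (code n x)] =
  (\sum_(D : {ffun 'I_m -> C n} | `[< P D >]) nu [set x | code n x = D])%E.
Proof.
rewrite (measure_finite_valued (@measurable_code n)); last first.
  by apply: measurable_finite_valued => D; exact: measurable_code.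
rewrite [RHS]big_mkcond; apply: eq_bigr => D _; case: asboolP => PD.
  congr (nu _); apply/seteqP; split=> x /=; first by case.
  by move=> xD; rewrite xD.
rewrite (_ : _ `&` _ = set0) ?measure0//.
by apply/seteqP; split=> x // -[] /= Px xD; apply: PD; rewrite -xD.
Qed.

Lemma measure_eq_box (mu nu : probability (m.-tuple (borel X)) R) :
  (forall n (D : {ffun 'I_m -> C n}),
     mu [set x | code n x = D] = nu [set x | code n x = D]) ->
  measure_eq mu nu.
Proof.
move=> munu; apply: measure_eq_code => n S /code_determinedE ->.
by rewrite !measure_code_sum; apply: eq_bigr => D _; exact: munu.
Qed.

(** * Tuples with a prescribed pattern *)

Variable e : {ffun 'I_m * 'I_m -> bool}.

Definition with_pattern : set (m.-tuple (borel X)) :=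
  [set x | pattern (tnth x : 'I_m -> X) = e].

Definition with_code_pattern n : set (m.-tuple (borel X)) :=
  [set x | pattern (code n x) = e].

(** Since the codes of a tuple eventually have its pattern, these sets increase
    to [with_pattern]; the sets [with_code_pattern n] themselves need not be
    monotone in [n]. *)
Let stable_from N : set (m.-tuple (borel X)) :=
  \bigcap_(n in [set n | (N <= n)%N]) with_code_pattern n.

Lemma measurable_with_code_pattern n : measurable (with_code_pattern n).
Proof.
by apply: (@measurable_code_determined n) => x y; rewrite /with_code_pattern /= => ->.
Qed.

Let measurable_stable_from N : measurable (stable_from N).
Proof.
by apply: bigcap_measurable => [|n _]; [exists N => /=|exact: measurable_with_code_pattern].
Qed.

Let with_patternE : with_pattern = \bigcup_N stable_from N.
Proof.
apply/seteqP; split=> x.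
  have [N NP] := code_pattern_stable x.
  by move=> xe; exists N => // n Nn; rewrite /with_code_pattern /= NP.
move=> [N _ Nx]; have [M MP] := code_pattern_stable x.
rewrite /with_pattern /= -(MP _ (leq_maxr N M)).
by apply: Nx; exact: leq_maxl.
Qed.

Lemma measurable_with_pattern : measurable with_pattern.
Proof. by rewrite with_patternE; exact: bigcupT_measurable. Qed.

(** Squeeze between the increasing sets [S `&` stable_from n], whose measures
    tend to that of [S] by continuity from below, and [S]. *)
Lemma cvg_with_code_pattern (nu : probability (m.-tuple (borel X)) R)
    (S : set (m.-tuple (borel X))) :
  nu with_pattern = 1%E -> measurable S ->
  nu (S `&` with_code_pattern n) @[n --> \oo] --> nu S.
Proof.
move=> nu1 mS.
have nuS : nu S = nu (\bigcup_n (S `&` stable_from n)).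
  by rewrite -setI_bigcupr -with_patternE probability_setI_full//; exact: measurable_with_pattern.
apply: (@squeeze_cvge _ _ _ _ (fun n => nu (S `&` stable_from n)) _ (cst (nu S))).
- apply: nearW => n; apply/andP; split.
    apply: le_measure; rewrite ?inE.
    + by apply: measurableI.
    + by apply: measurableI => //; exact: measurable_with_code_pattern.
    + by apply: setIS => x; apply => /=.
  apply: le_measure; rewrite ?inE//.
  by apply: measurableI => //; exact: measurable_with_code_pattern.
- rewrite nuS; apply: nondecreasing_cvg_mu.
  + by move=> n; exact: measurableI.
  + by apply: bigcupT_measurable => n; exact: measurableI.
  + move=> k n kn; apply/subsetPset; apply: setIS => x xk j /= nj.
    by apply: xk => /=; exact: leq_trans nj.
- exact: cvg_cst.
Qed.

End code.

(** * Invariant measures and equality patterns *)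

Section action.
Context {R : realType} {X : pmetricType R} {C : nat -> {fset set X}}.
Hypotheses (cX : compact [set: X]) (treeC : tree_structure C).
Context {G : groupType} {act : G -> X -> X}.
Hypotheses (actH : homeo_action act) (actT : extremely_transitive_wrt act C).

Lemma actK g : cancel (act g) (act g^-1%g).
Proof. by have [a1 aM _] := actH; move=> x; rewrite -aM mulVg a1. Qed.

Lemma measurable_act g :
  measurable_fun [set: borel X] (act g : borel X -> borel X).
Proof.
apply: (@measurability _ _ (borel X) (borel X) setT (act g) (@open X)) => // _ [U oU <-].
rewrite setTI; apply: sub_sigma_algebra.
by have [_ _ /(_ g)/continuousP] := actH; exact.
Qed.

Section diagonal.
Context {m : nat}.

Lemma measurable_diag_act g : measurable_fun [set: m.-tuple (borel X)]
  (diag_act act g : m.-tuple (borel X) -> m.-tuple (borel X)).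
Proof.
apply/measurable_fun_tnthP => i.
rewrite (_ : _ \o _ = act g \o (fun x : m.-tuple (borel X) => tnth x i)).
  by apply: measurableT_comp; [exact: measurable_act|exact: measurable_tnth].
by apply/funext => x /=; rewrite tnth_map.
Qed.

Lemma with_pattern_invariant (e : {ffun 'I_m * 'I_m -> bool}) g :
  diag_act act g @^-1` with_pattern (X := X) e = with_pattern e.
Proof.
apply/seteqP; split=> x; rewrite /with_pattern /= => <-.
  rewrite -(pattern_inj _ (can_inj (actK g))); apply/patternP => i j.
  by rewrite /= !tnth_map.
rewrite -[RHS](pattern_inj _ (can_inj (actK g))); apply/patternP => i j.
by rewrite /= !tnth_map.
Qed.

(** Extreme transitivity speaks of tuples of distinct pieces, so it is applied to
    the distinct values of [D] and to the corresponding values of [D']; equality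
    of the patterns makes this correspondence a well-defined injection. *)
Lemma ex_act_code n (D D' : {ffun 'I_m -> C n}) :
  pattern D = pattern D' ->
  exists g, forall i, act g @` val (D i) = val (D' i).
Proof.
move=> /patternP DD'.
case: m D D' DD' => [|m'] D D' DD'; first by exists 1%g; case.
(* The map sending each value of [D] to the value of [D'] at the same index. *)
pose f (A : C n) : C n := D' (odflt ord0 [pick i | D i == A]).
have fD i : f (D i) = D' i.
  rewrite /f; case: pickP => [j /=|/(_ i)]; last by rewrite eqxx.
  by rewrite DD' => /eqP.
pose s := undup (codom D).
have sD i : D i \in s by rewrite mem_undup codom_f.
pose A : (size s).-tuple (set X) := map_tuple val (in_tuple s).
pose B : (size s).-tuple (set X) := map_tuple val (map_tuple f (in_tuple s)).
have f_inj : {in s &, injective f}.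
  move=> a b; rewrite !mem_undup => /codomP[i ->] /codomP[j ->].
  by rewrite !fD => /eqP; rewrite -DD' => /eqP.
have sub (t : seq (C n)) : {subset map val t <= C n}.
  by move=> _ /mapP[a _ ->]; exact: fsvalP.
have uA : uniq A by rewrite /= map_inj_uniq ?undup_uniq//; exact: val_inj.
have uB : uniq B.
  rewrite /= map_inj_uniq; last exact: val_inj.
  by rewrite map_inj_in_uniq// undup_uniq.
have rn : (1 <= size s <= #|` C n|)%N.
  apply/andP; split; first by case: (s) (sD ord0).
  rewrite -(size_map val s); apply: uniq_leq_size => //; exact: sub.
have [g gAB] := actT rn uA (sub s) uB (sub (map f s)).
exists g => i; have si : (index (D i) s < size s)%N by rewrite index_mem.
have := gAB (Ordinal si).
rewrite !tnth_map !(tnth_nth (D i)) /= nth_index//.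
by rewrite fD.
Qed.

Lemma invariant_code (nu : probability (m.-tuple (borel X)) R) n
    (D D' : {ffun 'I_m -> C n}) :
  invariant_measures (Z := m.-tuple (borel X)) (diag_act act (m := m)) nu ->
  pattern D = pattern D' ->
  nu [set x | code treeC n x = D] = nu [set x | code treeC n x = D'].
Proof.
move=> nuI /ex_act_code[g gDD'].
rewrite -[RHS](nuI g); last exact: measurable_code.
rewrite !code_box; congr (nu _); apply/seteqP; split=> x /= xD i.
  by have /= <- := gDD' i; rewrite tnth_map; exists (tnth x i); first exact: xD.
have /= := xD i; have /= <- := gDD' i; rewrite tnth_map => -[y Dy].
by move=> /(can_inj (actK g)) <-.
Qed.

(** An invariant measure gives one and the same mass to all boxes whose code has
    pattern [e].  So the masses are those of a counting measure up to a factor,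
    which cancels in the cross products. *)
Lemma invariant_proportional (nu lam : probability (m.-tuple (borel X)) R)
    (e : {ffun 'I_m * 'I_m -> bool}) n (S : set (m.-tuple (borel X))) :
  invariant_measures (Z := m.-tuple (borel X)) (diag_act act (m := m)) nu ->
  invariant_measures (Z := m.-tuple (borel X)) (diag_act act (m := m)) lam ->
  code_determined treeC n S ->
  (nu (S `&` with_code_pattern treeC e n) * lam (with_code_pattern treeC e n) =
   lam (S `&` with_code_pattern treeC e n) * nu (with_code_pattern treeC e n))%E.
Proof.
move=> nuI lamI /code_determinedE SE.
set E := with_code_pattern treeC e n.
pose Q : set {ffun 'I_m -> C n} := [set D | pattern D = e].
pose P := [set code treeC n y | y in S] `&` Q.
have mass (rho : probability (m.-tuple (borel X)) R) :
    invariant_measures (Z := m.-tuple (borel X)) (diag_act act (m := m)) rho ->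
    exists c : R, forall P' : set {ffun 'I_m -> C n}, P' `<=` Q ->
    rho [set x | P' (code treeC n x)] =
      (c *+ #|[pred D | `[< P' D >]]|)%:E.
  move=> rhoI; have [[D0 QD0]|Q0] := pselect (Q !=set0); last first.
    exists 0%R => P' P'Q; rewrite mul0rn (_ : [set x | _] = set0) ?measure0//.
    by apply/seteqP; split=> // x /P'Q Qx; apply: Q0; exists (code treeC n x).
  exists (fine (rho [set x | code treeC n x = D0])) => P' P'Q.
  rewrite measure_code_sum -sumr_const -sumEFin; apply: eq_big => // D.
  move=> /asboolP/P'Q QD; rewrite fineK; last first.
    by apply: fin_num_measure; exact: measurable_code.
  by apply: invariant_code => //; rewrite QD QD0.
have EE : E = [set x | Q (code treeC n x)] by [].
have SEE : S `&` E = [set x | P (code treeC n x)].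
  by rewrite {1}SE EE; apply/seteqP; split.
have [c nuc] := mass _ nuI; have [c' lamc] := mass _ lamI.
rewrite SEE EE !nuc ?lamc//; try exact: subIsetr.
by rewrite -!EFinM !mulrnAl !mulrnAr (mulrC c).
Qed.

(** The limit of [invariant_proportional]: the masses of [with_code_pattern]
    tend to 1, so that the two measures themselves agree on sets determined by
    codes. *)
Lemma invariant_with_pattern_unique (nu lam : probability (m.-tuple (borel X)) R)
    (e : {ffun 'I_m * 'I_m -> bool}) :
  invariant_measures (Z := m.-tuple (borel X)) (diag_act act (m := m)) nu ->
  invariant_measures (Z := m.-tuple (borel X)) (diag_act act (m := m)) lam ->
  nu (with_pattern e) = 1%E -> lam (with_pattern e) = 1%E ->
  measure_eq nu lam.
Proof.
move=> nuI lamI nu1 lam1; apply: (measure_eq_code cX (treeC := treeC)) => k S kS.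
have mS := measurable_code_determined kS.
have cvg (rho rho' : probability (m.-tuple (borel X)) R) :
    rho (with_pattern e) = 1%E -> rho' (with_pattern e) = 1%E ->
    (rho (S `&` with_code_pattern treeC e n) *
     rho' (with_code_pattern treeC e n))%E @[n --> \oo] --> rho S.
  move=> rho1 rho'1; rewrite -[X in _ --> X]mule1.
  apply: cvgeM.
  - by apply: mule_def_fin => //; exact: fin_num_measure.
  - exact: (cvg_with_code_pattern cX).
  - rewrite -(probability_setT rho').
    under eq_fun do rewrite -[with_code_pattern _ _ _]setTI.
    exact: (cvg_with_code_pattern cX).
apply: (cvg_unique _ (cvg _ _ nu1 lam1)) => //.
apply: cvg_trans (cvg _ _ lam1 nu1); apply: near_eq_cvg.
exists k => // n /= kn.
by apply: invariant_proportional => //; exact: (code_determinedW kn).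
Qed.

(** Patterns partition the space into finitely many invariant sets, of mass 0 or
    1 each, with total mass 1. *)
Lemma ergodic_with_pattern (nu : probability (m.-tuple (borel X)) R) :
  ergodic_measures (Z := m.-tuple (borel X)) (diag_act act (m := m)) nu ->
  exists e, nu (with_pattern e) = 1%E.
Proof.
move=> [_ nuE]; apply: contrapT => /forallNP nu1.
have := measure_finite_valued
  (measurable_with_pattern cX treeC) nu (S := setT) measurableT.
rewrite [X in X = _]probability_setT big1 => [/eqP|e _]; first by rewrite onee_eq0.
rewrite setTI; have mE := measurable_with_pattern cX treeC e.
by have [//|/nu1//] := nuE _ mE (with_pattern_invariant e).
Qed.

(** If [A] is invariant with positive mass, then [nu] conditioned on [A] is
    invariant and carried by the same pattern, hence equal to [nu] by uniqueness;
    so [A] has the mass 1 that it has under the conditioned measure. *)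
Lemma with_pattern_ergodic (nu : probability (m.-tuple (borel X)) R) e :
  invariant_measures (Z := m.-tuple (borel X)) (diag_act act (m := m)) nu ->
  nu (with_pattern e) = 1%E ->
  ergodic_measures (Z := m.-tuple (borel X)) (diag_act act (m := m)) nu.
Proof.
move=> nuI nu1; split=> // A mA AI.
have [nuA0|nuA0] := eqVneq (nu A) 0%E; [by left|right].
pose rho : probability (m.-tuple (borel X)) R := mnormalize (mrestr nu mA) nu.
have rhoE U : rho U = (nu (U `&` A) * (fine (nu A))^-1%:E)%E.
  rewrite /rho /= /mnormalize /= /mrestr setTI (negbTE nuA0) /=.
  by rewrite lt_eqF// (le_lt_trans (probability_le1 nu mA))// ltry.
have fA : (fine (nu A))%:E = nu A by rewrite fineK// fin_num_measure.
have fA0 : fine (nu A) != 0%R by rewrite -eqe fA.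
have normA : (nu A * (fine (nu A))^-1%:E = 1)%E.
  by rewrite -[in X in (X * _)%E]fA -EFinM divff.
have rhoI : invariant_measures (Z := m.-tuple (borel X))
    (diag_act act (m := m)) rho.
  move=> g U mU; rewrite !rhoE; congr (_ * _)%E.
  rewrite -[in LHS](AI g) -preimage_setI; apply: nuI.
  exact: measurableI.
have rho1 : rho (with_pattern e) = 1%E.
  by rewrite rhoE setIC probability_setI_full//; exact: (measurable_with_pattern cX treeC e).
have <- : rho A = nu A by exact: (invariant_with_pattern_unique rhoI nuI rho1 nu1).
by rewrite rhoE setIid.
Qed.

End diagonal.

End action.

(** * Powers of the invariant measure *)

Section powers.
Context {R : realType} {X : pmetricType R} {C : nat -> {fset set X}}.
Hypotheses (cX : compact [set: X]) (treeC : tree_structure C).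
Context {G : groupType} {act : G -> X -> X}.
Hypotheses (actH : homeo_action act) (actT : extremely_transitive_wrt act C).

Lemma tuple_power_code (mu : probability (borel X) R) m n (D : {ffun 'I_m -> C n}) :
  tuple_power mu m [set x | code treeC n x = D] = (\prod_i mu (val (D i)))%E.
Proof.
rewrite code_box; apply: (tuple_power_box mu (A := fun i => val (D i))) => i.
by apply: sub_sigma_algebra; exact: open_piece.
Qed.

Lemma tuple_power_invariant (mu : probability (borel X) R) m :
  invariant_measures (Z := borel X) act mu ->
  invariant_measures (Z := m.-tuple (borel X)) (diag_act act (m := m))
    (tuple_power mu m).
Proof.
move=> muI g S mS.
pose h : m.-tuple (borel X) -> m.-tuple (borel X) := diag_act act g.
have mh : measurable_fun [set: m.-tuple (borel X)] h by exact: measurable_diag_act.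
(* The diagonal action is bundled as a measurable function, so that the image
   of the power measure is a probability. *)
pose hM := isMeasurableFun.Build _ _ _ _ h mh.
pose H : {mfun m.-tuple (borel X) >-> m.-tuple (borel X)} :=
  HB.pack_for {mfun m.-tuple (borel X) >-> m.-tuple (borel X)} h hM.
suff : measure_eq (distribution (tuple_power mu m) H) (tuple_power mu m) by exact.
apply: (measure_eq_box cX (treeC := treeC)) => n D.
rewrite tuple_power_code /distribution /pushforward.
have mD i : measurable (val (D i) : set (borel X)).
  by apply: sub_sigma_algebra; exact: open_piece.
pose B i : set (borel X) := act g @^-1` val (D i).
have hD : h @^-1` [set x | code treeC n x = D] =
    [set x : m.-tuple (borel X) | forall i, B i (tnth x i)].
  rewrite code_box.
  by apply/seteqP; split=> x /= xD i; have := xD i; rewrite tnth_map.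
transitivity (tuple_power mu m [set x | forall i, B i (tnth x i)]).
  by rewrite -hD.
rewrite tuple_power_box => [|i]; first by apply: eq_bigr => i _; exact: muI.
by rewrite -[X in measurable X]setTI; exact: measurable_act.
Qed.

(** Single points, seen as tuples of length 1, all have the same pattern, so this
    is the case of length 1 of [invariant_with_pattern_unique]. *)
Lemma invariant_unique (mu mu' : probability (borel X) R) :
  invariant_measures (Z := borel X) act mu ->
  invariant_measures (Z := borel X) act mu' -> measure_eq mu' mu.
Proof.
move=> muI mu'I S mS.
have box (rho : probability (borel X) R) :
    rho S = tuple_power rho 1 [set x | forall i, S (tnth x i)].
  by rewrite (tuple_power_box rho (A := fun=> S))// big_ord_recl big_ord0 mule1.
have one (x : 1.-tuple X) :
    pattern (tnth x) = pattern (id : 'I_1 -> 'I_1).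
  by apply/patternP => i j; rewrite !ord1 !eqxx.
have mS1 : measurable ([set x | forall i, S (tnth x i)] : set (1.-tuple (borel X))).
  rewrite (_ : [set x | _] = (fun x : 1.-tuple (borel X) => tnth x ord0) @^-1` S).
    by rewrite -[X in measurable X]setTI; exact: measurable_tnth.
  by apply/seteqP; split=> x /=; [exact|move=> Sx i; rewrite ord1].
have full (rho : probability (1.-tuple (borel X)) R) :
    rho (with_pattern (pattern (id : 'I_1 -> 'I_1))) = 1%E.
  rewrite (_ : with_pattern _ = setT) ?probability_setT//.
  by apply/seteqP; split=> // x _; exact: one.
transitivity (tuple_power mu' 1 [set x | forall i, S (tnth x i)]); first exact: box.
transitivity (tuple_power mu 1 [set x | forall i, S (tnth x i)]); last by rewrite -box.
have eq1 := invariant_with_pattern_unique cX treeC actH actT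
  (tuple_power_invariant (m := 1) mu'I) (tuple_power_invariant (m := 1) muI)
  (full _) (full _).
exact: (eq1 _ mS1).
Qed.

Lemma invariant_piece (mu : probability (borel X) R) n (A : C n) :
  invariant_measures (Z := borel X) act mu ->
  mu (val A) = (#|{: C n}|%:R^-1)%:E.
Proof.
move=> muI.
have mB (B : C n) : measurable (val B : set (borel X)).
  by apply: sub_sigma_algebra; exact: open_piece.
have muB (B : C n) : mu (val B) = mu (val A).
  pose cst1 B : {ffun 'I_1 -> C n} := [ffun=> B].
  have /(ex_act_code actT)[g gAB] : pattern (cst1 B) = pattern (cst1 A).
    by apply/patternP => i j; rewrite !ffunE !eqxx.
  have := gAB ord0; rewrite !ffunE => {}gAB.
  rewrite -[RHS](muI g)//; congr (mu _); apply/seteqP; split=> x /=.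
    by have /= <- := gAB; exists x.
  by have /= <- := gAB => -[y By] /(can_inj (actK actH g)) <-.
have := measure_finite_valued (@measurable_piece _ _ _ treeC n) mu (S := setT) measurableT.
rewrite [X in X = _]probability_setT => sum1.
have {sum1} : (1 = (fine (mu (val A)) *+ #|{: C n}|)%:E)%E.
  rewrite sum1 -sumr_const -sumEFin; apply: eq_bigr => B _.
  by rewrite setTI -pieceE fineK ?fin_num_measure//; exact: muB.
move=> -[muA].
have {}muA : (1 = fine (mu (val A)) * #|{: C n}|%:R)%R by rewrite mulr_natr.
rewrite -[LHS]fineK ?fin_num_measure//; congr EFin.
have nz : (#|{: C n}|%:R != 0 :> R)%R.
  by apply/eqP => k0; move: muA; rewrite k0 mulr0 => /eqP; rewrite oner_eq0.
by apply: (mulIf nz); rewrite mulVf.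
Qed.

Hypothesis X_perfect : perfect_set [set: X].

(** A perfect metric space is infinite, and any finite set of points is
    eventually separated by the partitions. *)
Lemma card_pieces_unbounded N : exists n, (N <= #|{: C n}|)%N.
Proof.
have infX : infinite_set [set: X].
  move=> finX; have /perfectTP/(_ point) := X_perfect; apply.
  rewrite -[[set point]]setCK openC.
  have /accessible_finite_set_closed : accessible_space X.
    by apply: hausdorff_accessible; exact: metric_hausdorff.
  apply; exact: sub_finite_set finX.
have [B _ NB] := infinite_set_fset N infX.
have [n nP] := code_pattern_stable cX treeC (in_tuple (enum_fset B)).
exists n; apply: leq_trans NB _.
have /patternP inj := nP n (leqnn n).
rewrite -[#|` B |](card_ord #|` B |).
apply: (@leq_card _ _ (code treeC n (in_tuple (enum_fset B)))) => i j /eqP.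
rewrite inj !(tnth_nth point) nth_uniq ?fset_uniq//.
by move=> /eqP /val_inj.
Qed.

(** The birthday bound: among the [k ^ m] maps from [m] points to [k] values, a
    proportion of at most [m ^ 2 / k] is not injective.  It is multiplied out by
    [k ^ m.+1] to stay in [nat]. *)
Lemma expn_leq_ffact k m : (k ^ m.+1 <= k * k ^_ m + m ^ 2 * k ^ m)%N.
Proof.
elim: m => [|m IHm]; first by rewrite ffactn0 expn1 muln1 leq_addr.
rewrite expnS; apply: leq_trans (leq_mul (leqnn k) IHm) _.
rewrite ffactnSr.
have le_ffact : (k ^_ m <= k ^ m)%N.
  elim: m {IHm} => // m IHm; rewrite ffactnSr expnSr.
  by apply: leq_mul => //; exact: leq_subr.
have ksub : (k <= (k - m) + m)%N by rewrite addnC -leq_subLR.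
have step : (k * k ^_ m <= k ^_ m * (k - m) + m * k ^ m)%N.
  apply: leq_trans (leq_mul ksub (leqnn _)) _.
  by rewrite mulnDl (mulnC (k - m)) leq_add2l leq_mul2l le_ffact orbT.
apply: (@leq_trans (k * (k ^_ m * (k - m) + m * k ^ m + m ^ 2 * k ^ m))%N).
  by rewrite leq_mul2l leq_add2r step orbT.
rewrite -addnA mulnDr leq_add2l -mulnDl mulnCA -expnS leq_mul2r.
rewrite -[(m + m ^ 2)%N]/(m + m * m)%N -mulSn -[(m.+1 ^ 2)%N]/(m.+1 * m.+1)%N.
by rewrite leq_mul2l leqnSn !orbT.
Qed.

(** Points in distinct pieces are distinct, and by [invariant_piece] the codes of
    level [n] are uniformly distributed under the power of [mu]; the birthday
    bound then gives a mass of at least [1 - m ^ 2 / k], where the number [k] of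
    pieces is unbounded. *)
Lemma tuple_power_distinct (mu : probability (borel X) R) m :
  invariant_measures (Z := borel X) act mu ->
  tuple_power mu m (with_pattern (pattern (id : 'I_m -> 'I_m))) = 1%E.
Proof.
move=> muI; set E := with_pattern _.
have mE : measurable E by exact: (measurable_with_pattern cX treeC).
pose Inj n : set {ffun 'I_m -> C n} := [set D | injective D].
have mass n : tuple_power mu m
    [set x | Inj n (code treeC n x)] =
    ((#|{: C n}| ^_ m)%:R / (#|{: C n}| ^ m)%:R)%:E.
  rewrite (measure_code_sum treeC (tuple_power mu m) (Inj n)).
  rewrite (eq_bigr (fun=> ((#|{: C n}| ^ m)%:R^-1)%:E)); last first.
    move=> D _; rewrite tuple_power_code.
    rewrite (eq_bigr (fun=> (#|{: C n}|%:R^-1)%:E)); last first.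
      by move=> i _; exact: invariant_piece.
    by rewrite prodEFin prodr_const card_ord natrX exprVn.
  rewrite sumEFin sumr_const -[RHS]/((_ * _)%R%:E) [in RHS]mulr_natl.
  congr ((_ *+ _)%R%:E); rewrite -[in RHS](card_ord m) -card_inj_ffuns cardsE.
  by apply: eq_card => D; rewrite ?inE; apply/asboolP/injectiveP.
have below n : ((1 - (m ^ 2)%:R / #|{: C n}|%:R)%:E <= tuple_power mu m E)%E.
  apply: (@le_trans _ _ (tuple_power mu m
    [set x | Inj n (code treeC n x)])).
    have k0 : (0 < #|{: C n}|%:R :> R)%R.
      by rewrite ltr0n; apply/card_gt0P; exists (piece treeC n point).
    have km0 : (0 < (#|{: C n}| ^ m)%:R :> R)%R by rewrite natrX exprn_gt0.
    rewrite mass lee_fin lerBlDr addf_div ?gt_eqF// ler_pdivlMr ?mulr_gt0// mul1r.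
    rewrite -!natrM -natrD ler_nat -expnSr [X in (_ <= X + _)%N]mulnC.
    exact: expn_leq_ffact.
  apply: le_measure; rewrite ?inE//.
    by apply: measurable_finite_valued => D; exact: measurable_code.
  move=> x /= xinj; apply/patternP => i j.
  apply/eqP/eqP => [xij|->//]; apply: xinj.
  by rewrite !ffunE xij.
have fE : (fine (tuple_power mu m E))%:E = tuple_power mu m E.
  by rewrite fineK// fin_num_measure.
apply/eqP; rewrite eq_le probability_le1//=; rewrite -fE lee_fin leNgt.
apply/negP; rewrite -subr_gt0; set p := fine _ => p1.
(* With more than [m ^ 2 / (1 - p)] pieces, the lower bound on the mass
   exceeds [p]. *)
pose N := Num.bound ((m ^ 2)%:R / (1 - p))%R.
have [n Nn] := card_pieces_unbounded N.
have := below n; rewrite -fE lee_fin -/p lerBlDr -lerBlDl; apply/negP.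
have lt_k : ((m ^ 2)%:R / (1 - p) < #|{: C n}|%:R)%R.
  apply: (@lt_le_trans _ _ N%:R%R); last by rewrite ler_nat.
  by apply: archi_boundP; rewrite divr_ge0// ltW.
have k0 : (0 < #|{: C n}|%:R :> R)%R.
  by apply: le_lt_trans lt_k; rewrite divr_ge0// ltW.
by rewrite -ltNge ltr_pdivrMr// mulrC -ltr_pdivrMr.
Qed.

End powers.

(** * Set partitions *)

Section partitions.
Context {m : nat}.
Implicit Types P Q : {set {set 'I_m}}.

(** The position of the coordinate that [block_embed I] copies into the
    coordinate [i]. *)
Definition block_index {r} (I : r.-tuple {set 'I_m}) (i : 'I_m) : nat :=
  find (fun B : {set 'I_m} => i \in B) I.

Lemma block_index_lt {r} (I : r.-tuple {set 'I_m}) i :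
  ordered_partition I -> (block_index I i < r)%N.
Proof.
move=> /andP[_ /and3P[/eqP cov _ _]]; rewrite -[X in (_ < X)%N](size_tuple I) -has_find.
have : i \in finset.cover [set:: I] by rewrite cov finset.inE.
by move=> /finset.bigcupP[B]; rewrite finset.inE => BI iB; apply/hasP; exists B.
Qed.

Lemma ordered_partition_enum P : finset.partition P [set: 'I_m] ->
  ordered_partition (enum_tuple P).
Proof. by move=> PP; rewrite /ordered_partition enum_uniq set_enum. Qed.

Lemma pattern_block_index P : finset.partition P [set: 'I_m] ->
  pattern (block_index (enum_tuple P)) = pattern (finset.pblock P).
Proof.
move=> PP; have IP := ordered_partition_enum PP.
have lt i := block_index_lt i IP.
have nthE i : finset.pblock P i = nth finset.set0 (enum P) (block_index (enum_tuple P) i).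
  have szi : (block_index (enum_tuple P) i < size (enum P))%N by rewrite -cardE.
  apply: finset.def_pblock; first by case/and3P: PP.
    by rewrite -mem_enum mem_nth.
  by apply: (nth_find finset.set0 (a := fun B : {set 'I_m} => i \in B)); rewrite has_find.
apply/patternP => i j; rewrite !nthE nth_uniq ?enum_uniq//; by rewrite -cardE.
Qed.

(** A partition is the set of classes of the relation of lying in one block. *)
Lemma partition_pattern_inj P Q :
  finset.partition P [set: 'I_m] -> finset.partition Q [set: 'I_m] ->
  pattern (finset.pblock P) = pattern (finset.pblock Q) -> P = Q.
Proof.
move=> PP QQ /patternP PQ.
rewrite -(equivalence_partition_pblock PP) -(equivalence_partition_pblock QQ).
congr (equivalence_partition _ _); apply/funext => i; apply/funext => j.
have covP A (AA : finset.partition A [set: 'I_m]) (k : 'I_m) : k \in finset.cover A.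
  by case/and3P: AA => /eqP -> _ _; rewrite finset.inE.
have trivP A (AA : finset.partition A [set: 'I_m]) : finset.trivIset A.
  by case/and3P: AA.
by rewrite -!finset.eq_pblock ?PQ ?(covP _ PP) ?(covP _ QQ) ?(trivP _ PP) ?(trivP _ QQ).
Qed.

Lemma ex_partition_pattern {T : eqType} (u : 'I_m -> T) :
  exists2 P, finset.partition P [set: 'I_m] & pattern (finset.pblock P) = pattern u.
Proof.
exists (preim_partition u [set: 'I_m]); first exact: preim_partitionP.
have PP := preim_partitionP u [set: 'I_m].
apply/patternP => i j; rewrite finset.eq_pblock.
- by rewrite pblock_equivalence_partition ?finset.inE//; split=> // /eqP ->.
- by case/and3P: PP.
- by case/and3P: PP => /eqP -> _ _; rewrite finset.inE.
Qed.

End partitions.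

(** * Measures carried by block diagonals *)

Section block_measure.
Context {R : realType} {X : pmetricType R} {C : nat -> {fset set X}}.
Hypotheses (cX : compact [set: X]) (treeC : tree_structure C).
Context {G : groupType} {act : G -> X -> X}.
Hypotheses (actH : homeo_action act) (actT : extremely_transitive_wrt act C).
Hypothesis X_perfect : perfect_set [set: X].
Context {mu : probability (borel X) R}.
Hypothesis muI : invariant_measures (Z := borel X) act mu.
Context {m r : nat} {I : r.-tuple {set 'I_m}}.
Hypothesis IP : ordered_partition I.

Let lam : probability (m.-tuple (borel X)) R :=
  distribution (tuple_power mu r) (block_embed I).

Lemma tnth_block_embed (x : r.-tuple (borel X)) i :
  tnth (block_embed I x) i = tnth x (Ordinal (block_index_lt i IP)).
Proof. by rewrite tnth_mktuple (tnth_nth point). Qed.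

Lemma block_embed_diag_act g (x : r.-tuple (borel X)) :
  diag_act act g (block_embed I x) =
  block_embed I (diag_act act g x : r.-tuple (borel X)).
Proof.
apply/eq_from_tnth => i; rewrite tnth_map.
transitivity (act g (tnth x (Ordinal (block_index_lt i IP)))).
  by congr (act g _); exact: tnth_block_embed.
by apply/esym; rewrite -[RHS]tnth_map; exact: tnth_block_embed.
Qed.

Lemma block_measure_invariant :
  invariant_measures (Z := m.-tuple (borel X)) (diag_act act (m := m)) lam.
Proof.
move=> g S mS; rewrite /lam /= /distribution /pushforward.
have mIS : measurable (block_embed I @^-1` S : set (r.-tuple (borel X))).
  by rewrite -[X in measurable X]setTI; exact: measurable_funP.
rewrite -[RHS](tuple_power_invariant cX treeC actH muI g mIS).
congr (tuple_power mu r _); apply/seteqP; split=> x Sx;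
  rewrite /preimage /=; [rewrite -block_embed_diag_act|rewrite block_embed_diag_act];
  exact: Sx.
Qed.

(** [block_embed I] sends tuples of distinct points to tuples whose pattern is
    that of the blocks. *)
Lemma block_measure_pattern : lam (with_pattern (pattern (block_index I))) = 1%E.
Proof.
apply/eqP; rewrite eq_le probability_le1/=; last exact: (measurable_with_pattern cX treeC).
rewrite -(tuple_power_distinct cX treeC actH actT X_perfect r muI).
rewrite /lam /= /distribution /pushforward.
apply: le_measure; rewrite ?inE.
- exact: (measurable_with_pattern cX treeC).
- rewrite -[X in measurable X]setTI; apply: measurable_funP => //.
  exact: (measurable_with_pattern cX treeC).
- move=> x /patternP xinj; apply/patternP => i j.
  by rewrite !tnth_block_embed xinj.
Qed.

End block_measure.

(** * Classification and count of the ergodic measures *)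

Theorem theorem8p6 (R : realType) (X : pmetricType R) (G : groupType)
    (act : G -> X -> X) (m : nat)
    (X_cantor : cantor_like X)
    (G_countable : countable [set: G])
    (act_homeo : homeo_action act)
    (act_et : extremely_transitive act)
    (m_ge1 : (1 <= m)%N)
    (MGX_neq0 : invariant_measures (Z := borel X) (R := R) act !=set0) :
  (exists mu : probability (borel X) R,
    [/\ invariant_measures (Z := borel X) act mu,
        forall mu' : probability (borel X) R,
          invariant_measures (Z := borel X) act mu' -> measure_eq mu' mu
      & forall nu : probability (m.-tuple (borel X)) R,
          ergodic_measures (Z := m.-tuple (borel X)) (diag_act act (m := m)) nu ->
          exists (r : nat) (I : r.-tuple {set 'I_m}),
            ordered_partition I /\
            measure_eq nu (distribution (tuple_power mu r) (block_embed I))]) /\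
  ([set on_measurable nu |
    nu in ergodic_measures (Z := m.-tuple (borel X)) (R := R) (diag_act act (m := m))]
  #= `I_(bell_number m))%card.
Proof.
have [X_perfect cX _ _] := X_cantor; have [C treeC actT] := act_et.
have [mu muI] := MGX_neq0.
pose lam (P : {set {set 'I_m}}) : probability (m.-tuple (borel X)) R :=
  distribution (tuple_power mu #|P|) (block_embed (enum_tuple P)).
have lamI P : finset.partition P [set: 'I_m] ->
    invariant_measures (Z := m.-tuple (borel X)) (diag_act act (m := m)) (lam P).
  by move=> /ordered_partition_enum; exact: (block_measure_invariant cX treeC).
have lam1 P : finset.partition P [set: 'I_m] ->
    lam P (with_pattern (pattern (finset.pblock P))) = 1%E.
  move=> PP; rewrite -pattern_block_index//.
  exact: (block_measure_pattern cX treeC act_homeo actT X_perfect muI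
    (ordered_partition_enum PP)).
have nu_lam (nu : probability (m.-tuple (borel X)) R) :
    ergodic_measures (Z := m.-tuple (borel X)) (diag_act act (m := m)) nu ->
    exists2 P, finset.partition P [set: 'I_m] & measure_eq nu (lam P).
  move=> nuE; have [e nue] := ergodic_with_pattern cX treeC act_homeo nuE.
  (* A pattern of full mass is that of some tuple, hence of a partition. *)
  have [x xe] : exists x, with_pattern (X := X) e x.
    apply: contrapT => /forallNP e0; move: nue.
    rewrite (_ : with_pattern e = set0) ?measure0.
      by move=> /esym/eqP; rewrite onee_eq0.
    by apply/seteqP; split=> // x /e0.
  have [P PP Px] := ex_partition_pattern (tnth x : 'I_m -> X).
  exists P => //; have [nuI _] := nuE.
  apply: (invariant_with_pattern_unique cX treeC act_homeo actT nuI (lamI _ PP) nue).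
  by rewrite -xe -Px lam1.
split.
  exists mu; split=> //.
    by move=> mu'; exact: (invariant_unique cX treeC act_homeo actT muI).
  move=> nu /nu_lam[P PP nuP]; exists #|P|, (enum_tuple P); split=> //.
  exact: ordered_partition_enum.
pose PT := {P : {set {set 'I_m}} | finset.partition P [set: 'I_m]}.
pose F (P : PT) := on_measurable (lam (val P)).
have -> : [set on_measurable nu | nu in ergodic_measures (Z := m.-tuple (borel X))
    (R := R) (diag_act act (m := m))] = F @` [set: PT].
  apply/seteqP; split=> [_ [nu /nu_lam[P PP nuP] <-]|_ [P _ <-]].
    exists (exist _ P PP) => //; apply/funext => -[S mS].
    by rewrite /on_measurable /=; exact/esym/nuP.
  exists (lam (val P)) => //.
  exact: (with_pattern_ergodic cX treeC act_homeo actT (lamI _ (valP P)) (lam1 _ (valP P))).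
(* Distinct patterns are disjoint, so two measures carried by them differ. *)
have F_inj : {in [set: PT] &, injective F}.
  move=> P Q _ _ FPQ; apply/val_inj; apply: (partition_pattern_inj (valP P) (valP Q)).
  apply: contrapT => neq.
  pose EP : set (m.-tuple (borel X)) := with_pattern (pattern (finset.pblock (val P))).
  pose EQ : set (m.-tuple (borel X)) := with_pattern (pattern (finset.pblock (val Q))).
  have mEP : measurable EP by exact: (measurable_with_pattern cX treeC).
  have mEQ : measurable EQ by exact: (measurable_with_pattern cX treeC).
  have QEP : lam (val Q) EP = 1%E.
    rewrite -(lam1 _ (valP P)); apply/esym.
    exact: (congr1 (fun f => f (exist _ EP mEP)) FPQ).
  have := probability_setI_full mEP mEQ (lam1 _ (valP Q)).
  rewrite QEP (_ : EP `&` EQ = set0) ?measure0.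
    by move=> /esym/eqP; rewrite onee_eq0.
  by apply/seteqP; split=> // x [xP xQ]; apply: neq; exact: (etrans (esym xP) xQ).
rewrite (card_eql (inj_card_eq F_inj)) /bell_number -card_sig.
rewrite (card_eqr card_II).
have <- : @enum_rank PT @` [set: PT] = [set: 'I_#|{: PT}|].
  by apply/seteqP; split=> // k _; exists (enum_val k) => //; exact: enum_valK.
by rewrite card_eq_sym; apply: inj_card_eq => P Q _ _; exact: enum_rank_inj.
Qed.
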